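(* Let $f(x)=ax^2+bx+c$ with $a\in\mathbb{N}$ and $b,c\in\mathbb{Z}$, let $D=b^2-4ac$, and let \[ A_0=\left[\frac{|b|+(|D|+1)/2}{2a}\right]+1 . \] Then the sequence $\{\lambda(f(n))\}_{n=A_0}^{\infty}$ is either a constant sequence or it changes sign infinitely often.
   Context: $\mathbb{N}$ denotes the set of positive integers. $\lambda$ denotes the Liouville function: $\lambda(n)=(-1)^{\Omega(n)}$ for positive integers $n$, where $\Omega(n)$ is the number of prime factors of $n$ counted with multiplicity. $[x]$ denotes the greatest integer not exceeding $x$. A sequence with values in $\{+1,-1\}$ changes sign infinitely often if it takes each of the values $+1$ and $-1$ for infinitely many indices. *)

(* Defs.v *)
From mathcomp Require Import all_boot all_order all_algebra.
From mathcomp Require Import ring lra zify.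

Set Implicit Arguments.
Unset Strict Implicit.
Unset Printing Implicit Defensive.

Import Order.TTheory GRing.Theory Num.Theory.
Local Open Scope ring_scope.

Definition bigOmega (n : nat) : nat := (\sum_(p <- primes n) logn p n)%N.

(* Only meaningful for positive n. *)
Definition liouville (n : nat) : int := (-1) ^+ bigOmega n.

Definition quad (a : nat) (b c x : int) : int := a%:Z * x ^+ 2 + b * x + c.

Definition quad_disc (a : nat) (b c : int) : int := b ^+ 2 - 4 * a%:Z * c.

(* The divisions are exact divisions in the rationals; only the outer bracket
   rounds. *)
Definition quad_start (a : nat) (b c : int) : int :=
  let D := quad_disc a b c in
  Num.floor ((`|b|%:~R + (`|D|%:~R + 1) / 2) / (2 * a%:R) : rat) + 1.

Definition constant_from (N0 : int) (u : int -> int) : Prop :=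
  exists e : int, forall n : int, N0 <= n -> u n = e.

Definition takes_infinitely_often_from (N0 : int) (u : int -> int) (e : int) :
    Prop :=
  forall N : int, exists n : int, [/\ N0 <= n, N <= n & u n = e].

Definition sign_changes_infinitely_often_from (N0 : int) (u : int -> int) :
    Prop :=
  takes_infinitely_often_from N0 u 1 /\ takes_infinitely_often_from N0 u (-1).

(* The absolute value turns the integer f(n) into a natural number; for
   n >= A_0 it changes nothing, by quad_gt0. *)
Definition liouville_quad (a : nat) (b c n : int) : int :=
  liouville `|quad a b c n|%N.

Lemma quad_gt0 (a : nat) (b c n : int) :
  (0 < a)%N -> quad_start a b c <= n -> 0 < quad a b c n.
Proof.
move=> a0; rewrite /quad_start lezD1 floor_lt_int.
move defD: (quad_disc a b c) => D.
have a0' : 0 < 2 * a%:R :> rat by rewrite mulr_gt0 // ltr0n.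
rewrite ltr_pdivrMr //.
move=> h.
have h2 : 2 * `|b| + `|D| + 1 < 4 * a%:Z * n.
  rewrite -(ltr_int rat) !rmorphD !rmorphM /= -[a%:~R]/(a%:R : rat); lra.
have a1 : 0 < 4 * a%:Z by rewrite mulr_gt0 // ltz_nat.
rewrite -(pmulr_rgt0 _ a1).
have -> : 4 * a%:Z * quad a b c n = (2 * a%:Z * n + b) ^+ 2 - D.
  by rewrite -defD /quad_disc /quad; ring.
have hb : - b <= `|b| by rewrite -normrN ler_norm.
have hD := ler_norm D.
have hD0 := normr_ge0 D.
clear h a0' a1.
have ht : `|D| + 1 < 2 * (2 * a%:Z * n + b).
  have -> : 2 * (2 * a%:Z * n + b) = 4 * a%:Z * n + 2 * b by ring.
  move: (4 * a%:Z * n) `|D| `|b| hb h2 {defD hD hD0} => m d b' hb h2; lra.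
clear h2 hb defD; move: (2 * a%:Z * n + b) D `|D| ht hD hD0 => t D d ht hD hD0.
have hsq : (d + 1) ^+ 2 < (2 * t) ^+ 2.
  by rewrite ltr_pXn2r // nnegrE; lra.
rewrite -(pmulr_rgt0 _ (isT : 0 < 4 :> int)).
have -> : 4 * (t ^+ 2 - D) =
    ((2 * t) ^+ 2 - (d + 1) ^+ 2) + ((d - 1) ^+ 2 + 4 * (d - D)) by ring.
by rewrite ltr_wpDr ?subr_gt0 // addr_ge0 ?sqr_ge0 // mulr_ge0 // subr_ge0.
Qed.

(* Main.v *)
(* Write 4 a f(n) = x^2 - D with x = 2 a n + b. The bound A_0 says that
   |D| + 1 < 2 x for n >= A_0, which for D <> 0 prevents d = 4 a f(n) from being
   a square. A solution of the Pell equation u^2 - d v^2 = 1 then carries the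
   solution (x, 1) of y^2 - d k^2 = D to a larger one with y congruent to x
   modulo 2 a, that is, to some m > n with f(m) = k^2 f(n). So every value taken
   from A_0 on is taken infinitely often. If D = 0, then 4 a f(n) is always a
   square and the sequence is constantly the value of the Liouville function
   at a. *)
Require Import Defs.
From mathcomp Require Import all_boot all_order all_algebra.
From mathcomp Require Import ring lra zify.
From Stdlib Require Import Classical_Prop.

Set Implicit Arguments.
Unset Strict Implicit.
Unset Printing Implicit Defensive.

Import Order.TTheory GRing.Theory Num.Theory.
Local Open Scope ring_scope.

(** Puts the sums for [m], [n] and [m * n] over one list of primes; the extra primes contribute
    exponent 0. *)
Lemma bigOmega_sub_primes (m n : nat) : (0 < n)%N -> {subset primes m <= primes n} ->
  bigOmega m = (\sum_(p <- primes n) logn p m)%N.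
Proof.
move=> n0 sub; rewrite /bigOmega [RHS](bigID (mem (primes m))) /=.
rewrite [X in (_ + X)%N]big1 ?addn0; last first.
  move=> p; rewrite -logn_gt0 lt0n negbK => /eqP //.
rewrite -[RHS]big_filter; apply: perm_big; apply: uniq_perm.
- exact: primes_uniq.
- by rewrite filter_uniq // primes_uniq.
- move=> p; rewrite mem_filter /=.
  by case: (boolP (p \in primes m)) => //= /sub ->.
Qed.

Lemma bigOmegaM (m n : nat) : (0 < m)%N -> (0 < n)%N ->
  bigOmega (m * n) = (bigOmega m + bigOmega n)%N.
Proof.
move=> m0 n0; have mn0 : (0 < m * n)%N by rewrite muln_gt0 m0.
rewrite (@bigOmega_sub_primes m (m * n)) //; last first.
  by move=> p pm; rewrite primesM // pm.
rewrite (@bigOmega_sub_primes n (m * n)) //; last first.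
  by move=> p pn; rewrite primesM // pn orbT.
by rewrite -big_split; apply: eq_bigr => p _; rewrite lognM.
Qed.

Lemma liouvilleM (m n : nat) : (0 < m)%N -> (0 < n)%N ->
  liouville (m * n) = liouville m * liouville n.
Proof. by move=> m0 n0; rewrite /liouville bigOmegaM // exprD. Qed.

Lemma liouville_sqr (n : nat) : liouville n * liouville n = 1.
Proof. by rewrite /liouville -expr2 sqrr_sign. Qed.

Lemma liouville_pm1 (n : nat) : liouville n = 1 \/ liouville n = -1.
Proof.
by rewrite /liouville -signr_odd; case: odd; [right | left]; rewrite ?expr1 ?expr0.
Qed.

(* A triple (A, B, C) stands for the form [A x^2 + 2 B x y + C y^2]; a step
   replaces one of the two basis vectors by their sum, keeping the end values
   A and C of opposite signs (a walk along the river of Conway's topograph). *)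
Definition river (d : int) (t : int * int * int) : Prop :=
  let: (A, B, C) := t in [/\ 0 < A, C < 0 & B ^+ 2 - A * C = d].

Definition river_step (t : int * int * int) : int * int * int :=
  let: (A, B, C) := t in
  let S := A + 2 * B + C in
  if 0 < S then (S, B + C, C) else (A, A + B, S).

Section Pell.

Variable d : int.
Hypothesis d_gt0 : 0 < d.
Hypothesis d_nonsquare : forall z : int, z ^+ 2 <> d.

Lemma river_step_river t : river d t -> river d (river_step t).
Proof.
case: t => [[A B] C] /= [A0 C0 e]; case: ifP => S0; split => //.
- by rewrite -e; ring.
(* [S] cannot vanish: otherwise [d] would be the square of [A + B]. *)
- have /eqP := @d_nonsquare (A + B).
  have -> : (A + B) ^+ 2 = d + A * (A + 2 * B + C) by rewrite -e; ring.
  have : A + 2 * B + C <> 0 -> A + 2 * B + C < 0 by lia.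
  move=> h /eqP ne; apply: h => h; apply: ne; rewrite h; lia.
- by rewrite -e; ring.
Qed.

(** For an output [(A, B, C)], the number [A - 2 * B + C] is positive after the first branch and
    negative after the second, so the branch can be read off and undone. *)
Lemma river_step_inj t1 t2 : river d t1 -> river d t2 ->
  river_step t1 = river_step t2 -> t1 = t2.
Proof.
case: t1 => [[A B] C]; case: t2 => [[A' B'] C'] /= [A0 C0 e] [A0' C0' e'].
case: ifP => S; case: ifP => S' [] h1 h2 h3; congr (_, _, _); lia.
Qed.

Lemma river_iter n : river d (iter n river_step (1, 0, - d)).
Proof.
elim: n => [|n IH] /=; first by split; lia.
exact: river_step_river.
Qed.

Let box := [seq i%:Z - d | i <- iota 0 (`|d| * 2).+1].

Lemma mem_box (z : int) : `|z| <= d -> z \in box.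
Proof.
move=> h; apply/mapP; exists `|(z + d)%R|%N; last lia.
by rewrite mem_iota; lia.
Qed.

(** Since [A] and [C] have opposite signs, [d] equals [B ^+ 2 + |A| |C|] with both factors at least
    1. *)
Lemma river_bounded A B C : river d (A, B, C) ->
  [/\ `|A| <= d, `|B| <= d & `|C| <= d].
Proof. by case=> A0 C0 e; split; nia. Qed.

(** Only finitely many triples are possible, so the orbit repeats; injectivity pulls the repetition
    back to the start. *)
Lemma river_periodic : exists2 n,
  (0 < n)%N & iter n river_step (1, 0, - d) = (1, 0, - d).
Proof.
set x := (1, 0, - d).
pose S := [seq (p, z) | p <- [seq (y, z) | y <- box, z <- box], z <- box].
have subS n : {subset traject river_step x n <= S}.
  move=> t /trajectP [i _ ->]; have := river_iter i; rewrite -/x.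
  case: (iter i _ x) => [[A B] C] /river_bounded [hA hB hC].
  by apply: allpairs_f; [apply: allpairs_f|]; exact: mem_box.
have /negPn : ~~ ~~ looping river_step x (size S).
  rewrite -looping_uniq; apply/negP => u.
  by have := uniq_leq_size u (@subS _); rewrite size_traject ltnn.
move=> /trajectP [i]; move: (size S) => k ltik eqki.
exists (k - i)%N; first by rewrite subn_gt0.
elim: i k ltik eqki => [|i IH] [|k] // lt e.
rewrite subSS; apply: IH => //.
by apply: river_step_inj e; exact: river_iter.
Qed.

Lemma river_basis n : exists u v u' v' : int,
  [/\ iter n.+1 river_step (1, 0, - d) =
        (u ^+ 2 - d * v ^+ 2, u * u' - d * v * v', u' ^+ 2 - d * v' ^+ 2),
      0 < u, 0 <= v, 0 < u' & 0 <= v'].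
Proof.
elim: n => [|n [u [v [u' [v' [e u0 v0 u'0 v'0]]]]]].
  exists 1, 0, 1, 1; split => //=.
  by case: ifP => h; [lia | congr (_, _, _); ring].
rewrite iterS e /=; case: ifP => h.
- by exists (u + u'), (v + v'), u', v'; split; try lia; congr (_, _, _); ring.
- by exists u, v, (u + u'), (v + v'); split; try lia; congr (_, _, _); ring.
Qed.

(* Over one period of the river the basis vector (u, v) starting from (1, 0)
   again represents 1, and v = 0 would contradict B = 0. *)
Theorem pell : exists u v : int, [/\ 0 < u, 0 < v & u ^+ 2 - d * v ^+ 2 = 1].
Proof.
have [[|n] // _ per] := river_periodic.
have [u [v [u' [v' [e u0 v0 u'0 v'0]]]]] := river_basis n.
move: e; rewrite per => -[e1 e2 _]; exists u, v; split => //.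
rewrite lt_neqAle v0 andbT; apply/eqP => v_eq0.
by move: e2; rewrite -v_eq0; nia.
Qed.

End Pell.

Lemma quad_disc_sqr (a : nat) (b c n : int) :
  4 * a%:Z * quad a b c n = (2 * a%:Z * n + b) ^+ 2 - quad_disc a b c.
Proof. by rewrite /quad_disc /quad; ring. Qed.

Lemma quad_start_le (a : nat) (b c n : int) :
  (0 < a)%N -> quad_start a b c <= n ->
  `|quad_disc a b c| + 1 < 2 * (2 * a%:Z * n + b).
Proof.
move=> a0; rewrite /quad_start lezD1 floor_lt_int.
move: (quad_disc a b c) => D.
have a0' : 0 < 2 * a%:R :> rat by rewrite mulr_gt0 // ltr0n.
rewrite ltr_pdivrMr // => h.
have : 2 * `|b| + `|D| + 1 < 4 * a%:Z * n.
  rewrite -(ltr_int rat) !rmorphD !rmorphM /= -[a%:~R]/(a%:R : rat); lra.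
lia.
Qed.

(* If [x^2 - D = z^2] with D nonzero, then [|D| = |x - z| |x + z| >= 2 |x| - 1]. *)
Lemma sqr_sub_nonsquare (x D z : int) :
  D != 0 -> `|D| + 1 < 2 * x -> z ^+ 2 <> x ^+ 2 - D.
Proof.
move=> D0 h e.
have {}e : D = (x - `|z|) * (x + `|z|) by rewrite -subr_sqr real_normK ?num_real // e; ring.
have := normr_ge0 z; move: `|z| e => w e w0.
have : x - w != 0 by apply/eqP => h0; move: D0; rewrite e h0 mul0r eqxx.
have := ler_norm D; have := ler_norm (- D); rewrite normrN.
case: (ltgtP (x - w) 0) => // hw; nia.
Qed.

Lemma liouville_quad_recurs (a : nat) (b c n : int) :
  (0 < a)%N -> quad_disc a b c != 0 -> quad_start a b c <= n ->
  exists2 m, n < m & liouville_quad a b c m = liouville_quad a b c n.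
Proof.
move=> a0 D0 hn; have f0 := quad_gt0 a0 hn; have hx := quad_start_le a0 hn.
set x := 2 * a%:Z * n + b in hx.
have x0 : 0 < x by lia.
have d0 : 0 < 4 * a%:Z * quad a b c n by rewrite !mulr_gt0 // ltz_nat.
have [|u [v [u0 v0 e]]] := pell d0.
  by move=> z; rewrite quad_disc_sqr; exact: sqr_sub_nonsquare.
(* Multiplying [x + sqrt d] by [(u + v sqrt d)^2], where [d = 4 a f(n)],
   preserves the norm [x^2 - d = D] and changes x by a multiple of [2 a]. *)
pose m := n + 4 * quad a b c n * v * (v * x + u).
pose k := 1 + 2 * (4 * a%:Z * quad a b c n) * v ^+ 2 + 2 * u * v * x.
have fm : quad a b c m = quad a b c n * k ^+ 2.
  apply/eqP; rewrite -subr_eq0; apply/eqP.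
  have -> : quad a b c m - quad a b c n * k ^+ 2 =
     (u ^+ 2 - 4 * a%:Z * quad a b c n * v ^+ 2 - 1) *
     (4 * quad a b c n * v ^+ 2 * (4 * a%:Z * quad a b c n - x ^+ 2)).
    by rewrite /m /k /x /quad; ring.
  by rewrite e subrr mul0r.
have k0 : 0 < k by rewrite /k; nia.
exists m; first by rewrite /m ltrDl !mulr_gt0 // addr_gt0 // mulr_gt0.
rewrite /liouville_quad fm expr2 !abszM !liouvilleM ?muln_gt0 ?absz_gt0 ?gt_eqF //.
by rewrite liouville_sqr mulr1.
Qed.

Lemma liouville_quad_infinitely_often (a : nat) (b c n : int) :
  (0 < a)%N -> quad_disc a b c != 0 -> quad_start a b c <= n ->
  takes_infinitely_often_from (quad_start a b c) (liouville_quad a b c)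
    (liouville_quad a b c n).
Proof.
move=> a0 D0 hn N.
have [m [hm hnm e]] : exists m, [/\ quad_start a b c <= m,
    n + `|N - n|%N%:Z <= m & liouville_quad a b c m = liouville_quad a b c n].
  elim: `|N - n|%N => [|k [m [hm hk e]]]; first by exists n; split => //; lia.
  have [m' lt e'] := liouville_quad_recurs a0 D0 hm.
  by exists m'; split; [lia | lia | rewrite e'].
by exists m; split => //; lia.
Qed.

(** Here [4 a f(n)] is a nonzero square, so the signs at [a] and at [f(n)] have product 1. *)
Lemma liouville_quad_disc0 (a : nat) (b c n : int) :
  (0 < a)%N -> quad_disc a b c = 0 -> quad_start a b c <= n ->
  liouville_quad a b c n = liouville a.
Proof.
move=> a0 D0 hn; have f0 := quad_gt0 a0 hn.
have x0 : 0 < 2 * a%:Z * n + b by have := quad_start_le a0 hn; lia.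
have := quad_disc_sqr a b c n; rewrite D0 subr0 => /(congr1 absz).
rewrite expr2 !abszM (_ : `|4|%N = 2 * 2)%N // => /(congr1 liouville).
rewrite !liouvilleM ?muln_gt0 ?absz_gt0 ?a0 ?gt_eqF //.
rewrite !liouville_sqr mul1r /liouville_quad /= => e.
by rewrite -[LHS]mul1r -(liouville_sqr a) -mulrA e mulr1.
Qed.

Theorem theorem2p3 (a : nat) (b c : int) (ha : (0 < a)%N) :
  let A0 := quad_start a b c in
  let u := liouville_quad a b c in
  constant_from A0 u \/ sign_changes_infinitely_often_from A0 u.
Proof.
move=> A0 u.
have [D0 | D0] := eqVneq (quad_disc a b c) 0.
  by left; exists (liouville a) => n; exact: liouville_quad_disc0.
have inf n e : A0 <= n -> u n = e -> takes_infinitely_often_from A0 u e.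
  by move=> hn <-; exact: liouville_quad_infinitely_often.
have pm n : u n = 1 \/ u n = -1 by exact: liouville_pm1.
(* By [inf], it only matters which of the two signs occur from [A0] on. *)
case: (classic (exists2 n, A0 <= n & u n = 1)) => [[n hn en] | no1]; last first.
  by left; exists (-1) => n hn; case: (pm n) => // h; case: no1; exists n.
case: (classic (exists2 n, A0 <= n & u n = -1)) => [[m hm em] | noN1]; last first.
  by left; exists 1 => k hk; case: (pm k) => // h; case: noN1; exists k.
by right; split; [exact: inf hn en | exact: inf hm em].
Qed.
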